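(* Let $\varphi=\varphi_{\mathcal{C},\{\mathcal{T}_i\}}$ be a state on $\mathbb{C}\langle x_1,\ldots,x_d\rangle$ with a MOPS, represented on the full Fock space by the operators $\mathcal{X}_i=a_i^++\mathcal{T}_i+a_i^-\mathcal{C}$. Let $$\mathcal{Z}_i=\mathcal{X}_i-a_i^{b-}\mathcal{C}^{(1)}=a_i^++\mathcal{T}_i+\tilde a_i^{b-},\qquad \tilde a_i^{b-}=\begin{cases}0&\text{on }\mathcal{H}^{\otimes k},\ k\le1,\\ a_i^-\mathcal{C}&\text{on }\mathcal{H}^{\otimes k},\ k\ge2.\end{cases}$$ Then the Boolean cumulant functional $\eta$ of $\varphi$ is given by $\eta[x_i]=\mathcal{T}_i^{(0)}$ and, for all $i,j$ and all multi-indices $\vec u$ (including $\vec u=\emptyset$), $$\eta[x_ix_{\vec u}x_j]=\mathcal{C}_i\,\langle e_i,\mathcal{Z}_{\vec u}e_j\rangle=\langle\Omega,\;a_i^{b-}\mathcal{C}^{(1)}\,\mathcal{Z}_{\vec u}\,a_j^+\Omega\rangle.$$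
   Context: Multi-indices $\vec u\in\{1,\ldots,d\}^k$; $x_{\vec u}=x_{u(1)}\cdots x_{u(k)}$, $\mathcal{Z}_{\vec u}=\mathcal{Z}_{u(1)}\cdots\mathcal{Z}_{u(k)}$. $\mathcal{H}=\mathbb{C}^d$ with orthonormal basis $e_1,\ldots,e_d$; the algebraic full Fock space is $\mathbb{C}\Omega\oplus\bigoplus_{k\ge1}\mathcal{H}^{\otimes k}$ ($\mathcal{H}^{\otimes0}=\mathbb{C}\Omega$), with $\langle\cdot,\cdot\rangle$ the standard inner product (so $\langle e_i,\cdot\rangle$ and $\langle\Omega,\cdot\rangle$ extract coefficients). Let $e_{\vec u}=e_{u(1)}\otimes\cdots\otimes e_{u(k)}$. The operator $a_i^+$ tensors by $e_i$ on the left ($a_i^+\Omega=e_i$); $a_i^-e_{\vec u}=\delta_{i,u(1)}e_{(u(2),\ldots,u(k))}$, $a_i^-e_j=\delta_{ij}\Omega$, $a_i^-\Omega=0$; the Boolean annihilation operator $a_i^{b-}$ equals $a_i^-$ on $\mathcal{H}^{\otimes k}$, $k\le1$, and $0$ on $\mathcal{H}^{\otimes k}$, $k\ge2$. For each $k\ge1$, $\mathcal{C}^{(k)}$ is a diagonal non-negative $d^k\times d^k$ matrix, $\mathcal{C}^{(k)}e_{\vec u}=\mathcal{C}_{\vec u}e_{\vec u}$; for each $i$ and $k\ge0$, $\mathcal{T}_i^{(k)}$ is a $d^k\times d^k$ matrix acting on $\mathcal{H}^{\otimes k}$; they satisfy $(\mathcal{T}_i^{(k)})^*\mathcal{K}^{(k)}=\mathcal{K}^{(k)}\mathcal{T}_i^{(k)}$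 with $\mathcal{K}^{(k)}=(I^{\otimes(k-1)}\otimes\mathcal{C}^{(1)})\cdots(I\otimes\mathcal{C}^{(k-1)})\mathcal{C}^{(k)}$. $\mathcal{T}_i,\mathcal{C}$ act on the $k$-th component as $\mathcal{T}_i^{(k)},\mathcal{C}^{(k)}$; $\mathcal{T}_i^{(0)}$ is a scalar. The state $\varphi_{\mathcal{C},\{\mathcal{T}_i\}}$ is $\varphi[P(x_1,\ldots,x_d)]=\langle\Omega,P(\mathcal{X}_1,\ldots,\mathcal{X}_d)\Omega\rangle$; the states with a monic orthogonal polynomial system (MOPS: monic $P_{\vec u}=x_{\vec u}+$ lower-order terms with $\varphi[P_{\vec u}^*P_{\vec v}]=0$ for $\vec u\ne\vec v$) are exactly the states of this form. The Boolean cumulant functional $\eta$ is the linear functional on $\mathbb{C}\langle\mathbf{x}\rangle$ with $\eta[1]=0$ and $\varphi[x_{\vec u}]=\sum_\pi\prod_{B\in\pi}\eta[\prod_{i\in B}x_{u(i)}]$, the sum over interval partitions $\pi$ of $\{1,\ldots,|\vec u|\}$. *)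

(* Defs.v *)
From mathcomp Require Import all_boot all_order all_algebra.
From mathcomp Require Import finmap reals complex monalg.

Set Implicit Arguments.
Unset Strict Implicit.
Unset Printing Implicit Defensive.

Import Order.TTheory GRing.Theory Num.Theory.

Local Open Scope ring_scope.
Local Open Scope sesquilinear_scope.

(* A multi-index u is a word [seq 'I_d]; letters are numbered from 0. *)

(** * Non-commutative polynomials *)

(* C<x_1, ..., x_d> is the algebra of the free monoid {fmonom 'I_d} over C. *)
Notation ncpoly R d := {malg R[i][{fmonom 'I_d}]}.

Section Polynomials.
Variables (R : realType) (d : nat).

Definition ncvar (i : 'I_d) : ncpoly R d := << fmu i >>.

Definition ncmonom (u : seq 'I_d) : ncpoly R d := \prod_(i <- u) ncvar i.

(* The conjugate-linear anti-automorphism with x_i^* = x_i. *)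
Definition ncstar (P : ncpoly R d) : ncpoly R d :=
  \sum_(m <- msupp P) << (P@_m)^* *g FMonom (rev m) >>.

Definition is_state (phi : {scalar ncpoly R d}) : Prop :=
  phi 1 = 1 /\ forall P, 0 <= phi (ncstar P * P).

Definition is_monic_at (u : seq 'I_d) (P : ncpoly R d) : Prop :=
  {in msupp (P - ncmonom u), forall m, (fdeg m < size u)%N}.

Definition has_MOPS (phi : {scalar ncpoly R d}) : Prop :=
  exists P : seq 'I_d -> ncpoly R d,
    (forall u, is_monic_at u (P u)) /\
    (forall u v, u != v -> phi (ncstar (P u) * P v) = 0).

End Polynomials.

(** * Boolean cumulants *)

Definition is_interval (n : nat) (B : {set 'I_n}) : bool :=
  [forall i in B, forall k in B, forall j : 'I_n,
     ((i <= j)%N && (j <= k)%N) ==> (j \in B)].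

Definition interval_partition (n : nat) (p : {set {set 'I_n}}) : bool :=
  partition p [set: 'I_n] && [forall B in p, is_interval B].

(* [enum B] lists the block B in increasing order. *)
Definition is_boolean_cumulant (R : realType) (d : nat)
    (phi eta : {scalar ncpoly R d}) : Prop :=
  eta 1 = 0 /\
  forall (n : nat) (u : n.-tuple 'I_d),
    phi (ncmonom R u) =
      \sum_(p : {set {set 'I_n}} | interval_partition p)
        \prod_(B in p) eta (\prod_(i <- enum B) ncvar R (tnth u i)).

(** * The algebraic full Fock space *)

(* The free C-module on all words: the word u stands for e_u, the empty word
   for Omega, and H^{(x) k} is the span of the words of length k. *)
Notation fock R d := {malg R[i][seq 'I_d]}.

(* d^k x d^k matrices, with rows and columns indexed by the words of length k
   through [enum_rank]. *)
Definition tmx (R : realType) (d k : nat) := 'M[R[i]]_#|{: k.-tuple 'I_d}|.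

Section Fock.
Variables (R : realType) (d : nat).

Local Notation C := R[i].
Local Notation fock := (fock R d).
Local Notation tmx := (tmx R d).
Implicit Types (i : 'I_d) (u v w : seq 'I_d) (f g : fock).

Definition fbasis u : fock := << u >>.

Definition vac : fock := fbasis [::].

(* Conjugate-linear in the first argument. *)
Definition fdot f g : C := \sum_(w <- msupp f) (f@_w)^* * g@_w.

(* The linear operator with prescribed values on the basis. *)
Definition flin (h : seq 'I_d -> fock) f : fock :=
  \sum_(w <- msupp f) f@_w *: h w.

(* <e_u, A e_v>; it is 0 unless u and v both have length k. *)
Definition tcoef k (A : tmx k) u v : C :=
  if (insub u, insub v) is (Some u', Some v')
  then A (enum_rank (u' : k.-tuple 'I_d)) (enum_rank (v' : k.-tuple 'I_d))
  else 0.

(* The action of A on the component H^{(x) k}, extended by 0 to the others. *)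
Definition op_level k (A : tmx k) : fock -> fock :=
  flin (fun w => \sum_(u : k.-tuple 'I_d) tcoef A u w *: fbasis u).

(* The operator acting as A k on H^{(x) k}, for every k. *)
Definition op_diag (A : forall k, tmx k) : fock -> fock :=
  flin (fun w => op_level (A (size w)) (fbasis w)).

Definition acre i : fock -> fock := flin (fun w => fbasis (i :: w)).

Definition aann i : fock -> fock :=
  flin (fun w => if w is j :: w' then (i == j)%:R *: fbasis w' else 0).

Definition bann i : fock -> fock :=
  flin (fun w => if (size w <= 1)%N then aann i (fbasis w) else 0).

(* For j <= k, the matrix of I^{(x) (k-j)} (x) A on H^{(x) k}. *)
Definition tampl k j (A : tmx j) : tmx k :=
  \matrix_(p, q)
    let u : k.-tuple 'I_d := enum_val p in
    let v : k.-tuple 'I_d := enum_val q in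
    (take (k - j) u == take (k - j) v)%:R *
      tcoef A (drop (k - j) u) (drop (k - j) v).

(* The factors are multiplied in the order of increasing j; K^{(0)} = 1. *)
Definition tkernel (Cm : forall k, tmx k) k : tmx k :=
  \big[mulmx/1%:M]_(1 <= j < k.+1) tampl k (Cm j).

(* C^{(0)} is unconstrained: it never matters since a_i^- kills Omega. *)
Definition fock_data (Cm : forall k, tmx k) (T : 'I_d -> forall k, tmx k) :
    Prop :=
  [/\ forall k, (0 < k)%N -> is_diag_mx (Cm k),
      forall k, (0 < k)%N -> forall u, 0 <= tcoef (Cm k) u u
    & forall i k, (T i k) ^t* *m tkernel Cm k = tkernel Cm k *m T i k].

Definition opX (Cm : forall k, tmx k) (T : 'I_d -> forall k, tmx k) i f : fock :=
  acre i f + op_diag (T i) f + aann i (op_diag Cm f).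

Definition opZ (Cm : forall k, tmx k) (T : 'I_d -> forall k, tmx k) i f : fock :=
  opX Cm T i f - bann i (op_level (Cm 1) f).

(* 0 on H^{(x) k} for k <= 1, and a_i^- C on H^{(x) k} for k >= 2. *)
Definition btann (Cm : forall k, tmx k) i : fock -> fock :=
  flin (fun w => if (size w <= 1)%N then 0 else aann i (op_diag Cm (fbasis w))).

(* Y_u = Y_{u(1)} ... Y_{u(k)} *)
Definition opword (Y : 'I_d -> fock -> fock) u : fock -> fock :=
  foldr (fun i Yv => Y i \o Yv) id u.

(* P(Y_1, ..., Y_d) *)
Definition opeval (Y : 'I_d -> fock -> fock) (P : ncpoly R d) f : fock :=
  \sum_(m <- msupp P) P@_m *: opword Y m f.

End Fock.

(* Main.v *)
Require Import Defs.
From HB Require Import structures.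
From mathcomp Require Import all_boot all_order all_algebra.
From mathcomp Require Import finmap reals complex monalg.

(** The moments of phi and its Boolean cumulants determine each other through
    the recursion on the last block of an interval partition,

      phi[x_v] = \sum_(l < |v|) phi[x_(v_1 ... v_l)] eta[x_(v_(l+1) ... v_n)],

    whose l = 0 term is eta[x_v]: any functional that satisfies the same
    recursion with the same moments is the cumulant functional
    ([boolean_cumulant_of_rec]).  So it suffices to find this recursion in the
    Fock space.

    There X_i = Z_i + C_i <e_i, .> Omega ([opX_opZ], where the diagonality of
    C^(1) enters).  Apply X_u X_j to Omega, rightmost factor first:
    X_j Omega = e_j + T_j^(0) Omega, and T_j^(0) X_u Omega is the term where the
    last block is the singleton {j}.  In X_u e_j, expand every X_i
    as above until the first rank-one term is met, say at position l; it
    contributes C_(u_l) <e_(u_l), Z_(u_(l+1) ...) e_j> X_(u_1 ... u_(l-1)) Omega,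
    which is a cumulant candidate times a shorter
    moment vector ([opX_word_split]).  The remaining term Z_u e_j has no
    component along Omega since the Z_i preserve the span of the tensors of
    degree at least 1 ([opZ_no_vac]).  Taking the coefficient of Omega gives
    the recursion ([fmoment_rec]). *)

Set Implicit Arguments.
Unset Strict Implicit.
Unset Printing Implicit Defensive.

Import Order.TTheory GRing.Theory Num.Theory.

Local Open Scope ring_scope.

(** * Sums over interval partitions *)

Section IntervalPartitionSums.
Variables (A : comNzRingType) (n : nat) (w : {set 'I_n} -> A).

Definition segment (j k : nat) : {set 'I_n} := [set i : 'I_n | (j <= i < k)%N].

Definition interval_partition_of (D : {set 'I_n}) (p : {set {set 'I_n}}) : bool :=
  partition p D && [forall B in p, is_interval B].

(** The partitions live in a fixed ['I_n] for every k, so that the recursion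
    on k needs no transport between ordinal types. *)
Definition ipsum (k : nat) : A :=
  \sum_(p | interval_partition_of (segment 0 k) p) \prod_(B in p) w B.

Lemma segment_interval j k : is_interval (segment j k).
Proof.
apply/forall_inP => a; rewrite inE => /andP[ja ak].
apply/forall_inP => b; rewrite inE => /andP[jb bk].
apply/forallP => c; apply/implyP => /andP[ac cb]; rewrite inE.
by rewrite (leq_trans ja ac) (leq_ltn_trans cb bk).
Qed.

Lemma is_intervalP (B : {set 'I_n}) (a b c : 'I_n) :
  is_interval B -> a \in B -> b \in B -> (a <= c <= b)%N -> c \in B.
Proof.
by move=> /forall_inP/(_ a)/[swap] aB /(_ aB)/forall_inP/(_ b)/[swap] bB
          /(_ bB)/forallP/(_ c)/implyP; apply.
Qed.

(** The left end of the block of k; by [last_block_segment] the default value k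
    is only reached outside of interval partitions of the initial segment. *)
Definition last_start (k : 'I_n) (p : {set {set 'I_n}}) : 'I_n :=
  odflt k [pick j : 'I_n | (j <= k)%N && (segment j k.+1 \in p)].

(** Blocks that share k coincide, and a segment determines its left end. *)
Lemma segment_start_unique (k i j : 'I_n) (p : {set {set 'I_n}}) :
    trivIset p -> (i <= k)%N -> (j <= k)%N ->
  segment i k.+1 \in p -> segment j k.+1 \in p -> i = j.
Proof.
move=> tp ik jk ip jp; apply/val_inj => /=.
have e : segment i k.+1 = segment j k.+1.
  rewrite -(def_pblock (x := k) tp ip) ?inE ?ik ?ltnSn //.
  by rewrite (def_pblock tp jp) // inE jk ltnSn.
apply/eqP; rewrite eqn_leq.
have /[!inE]: j \in segment i k.+1 by rewrite e inE leqnn ltnS.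
have /[!inE]: i \in segment j k.+1 by rewrite -e inE leqnn ltnS.
by case/andP=> -> _ /andP[-> _].
Qed.

(** The block of k, being an interval, fills the gap between its minimum and
    k. *)
Lemma last_block_segment (k : 'I_n) (p : {set {set 'I_n}}) :
    interval_partition_of (segment 0 k.+1) p ->
  exists2 j : 'I_n, (j <= k)%N & segment j k.+1 \in p.
Proof.
case/andP=> pp /forall_inP pint.
have kc : k \in cover p by rewrite (cover_partition pp) inE /= ltnSn.
have Bp := pblock_mem kc; have kB : k \in pblock p k by rewrite mem_pblock.
case: (arg_minnP (P := mem (pblock p k)) (fun i : 'I_n => i : nat) kB) => j jB jmin.
have jk : (j <= k)%N by apply: jmin.
exists j => //; suff <- : pblock p k = segment j k.+1 by [].
apply/setP => i; rewrite inE; apply/idP/idP => [iB|/andP[ji ik]].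
  rewrite (jmin _ iB) /=.
  by have /subsetP/(_ _ iB) := partitionS pp Bp; rewrite inE.
by apply: (is_intervalP (pint _ Bp) jB kB); rewrite ji -ltnS.
Qed.

Lemma last_startE (k j : 'I_n) (p : {set {set 'I_n}}) : (j <= k)%N ->
    interval_partition_of (segment 0 k.+1) p ->
  (last_start k p == j) = (segment j k.+1 \in p).
Proof.
move=> jk pp; have tp := partition_trivIset (proj1 (andP pp)).
rewrite /last_start; case: pickP => [i /andP[ik ip] /=|none].
  apply/eqP/idP => [<- //|jp]; exact: (segment_start_unique tp ik jk).
by have [i ik ip] := last_block_segment pp; have := none i; rewrite ik ip.
Qed.

Lemma segment0_split (j k : nat) : (j <= k)%N ->
  segment 0 k = segment j k :|: segment 0 j.
Proof.
move=> jk; apply/setP => i; rewrite !inE /=.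
by case: (leqP j i) => [_|ij] /=; rewrite ?orbF // (leq_trans ij jk).
Qed.

Lemma segment_disjoint (j k : nat) : [disjoint segment j k & segment 0 j].
Proof.
rewrite disjoint_subset; apply/subsetP => i.
by rewrite !inE /= => /andP[ji _]; rewrite -leqNgt.
Qed.

Lemma segment_notin (k j : 'I_n) (q : {set {set 'I_n}}) :
    (j <= k)%N -> interval_partition_of (segment 0 j) q ->
  segment j k.+1 \notin q.
Proof.
move=> jk /andP[qq _]; apply/negP => /(partitionS qq)/subsetP/(_ j).
by rewrite !inE leqnn ltnS jk ltnn => /(_ isT).
Qed.

(** Adding or deleting the last block: the bijection behind [ipsum_rec]. *)
Lemma interval_partition_add (k j : 'I_n) (q : {set {set 'I_n}}) :
    (j <= k)%N -> segment j k.+1 \notin q ->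
  interval_partition_of (segment 0 k.+1) (segment j k.+1 |: q) =
  interval_partition_of (segment 0 j) q.
Proof.
move=> jk nq; have jk1 : (j <= k.+1)%N by exact: leqW.
have jS : j \in segment j k.+1 by rewrite inE leqnn ltnS.
apply/andP/andP => [[pp /forall_inP pint]|[qq /forall_inP qint]]; split.
- have /(partitionD1 pp) : segment j k.+1 \in segment j k.+1 |: q by exact: setU11.
  rewrite setU1K // (segment0_split jk1) setDUl setDv set0U.
  suff -> : segment 0 j :\: segment j k.+1 = segment 0 j by [].
  by apply/setDidPl; rewrite disjoint_sym segment_disjoint.
- by apply/forall_inP => B Bq; apply: pint; rewrite setU1r.
- rewrite (segment0_split jk1); apply: partitionU1 => //.
    by apply/set0Pn; exists j.
  exact: segment_disjoint.
- apply/forall_inP => B; rewrite in_setU1 => /predU1P[->|]; last exact: qint.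
  exact: segment_interval.
Qed.

Lemma ipsum0 : ipsum 0 = 1.
Proof.
have s0 : segment 0 0 = set0 by apply/setP => i; rewrite !inE.
rewrite /ipsum (big_pred1 set0) ?big_set0 // => p.
rewrite /interval_partition_of s0 partition_set0 /=.
by case: eqP => //= ->; apply/forall_inP => B; rewrite inE.
Qed.

(** Sort the interval partitions by the left end j of the block of k; removing
    that block leaves an arbitrary interval partition of the points below j. *)
Lemma ipsum_rec (k : nat) : (k < n)%N ->
  ipsum k.+1 = \sum_(j < k.+1) ipsum j * w (segment j k.+1).
Proof.
move=> kn; pose k' := Ordinal kn.
rewrite (big_ord_widen n (fun j => ipsum j * w (segment j k.+1))) //.
rewrite /ipsum (partition_big (last_start k') (fun j : 'I_n => (j < k.+1)%N)); last first.
  move=> p _; rewrite ltnS /last_start; case: pickP => [i /andP[]//|_]; exact: leqnn.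
apply: eq_bigr => j jk; rewrite big_distrl /=.
rewrite ltnS in jk; pose S := segment j k.+1.
rewrite (reindex_onto (fun q => S |: q) (fun p => p :\ S)) /=; last first.
  by move=> p /andP[pp]; rewrite (last_startE (k := k') jk pp); exact: setD1K.
apply: eq_big => [q|q].
  (* If S is already in q, then deleting it from S |: q does not give q back. *)
  case Sq: (S \in q).
    rewrite [RHS]negbTE; last first.
      by apply/negP => /(segment_notin (k := k') jk); rewrite /S in Sq; rewrite Sq.
    by apply/negP => /andP[_ /eqP e]; move: Sq; rewrite -e !inE eqxx.
  have nSq := negbT Sq.
  have := interval_partition_add (k := k') jk nSq; rewrite -/S /= => <-.
  rewrite setU1K // eqxx andbT.
  case pp: (interval_partition_of _ _) => //=.
  by rewrite (last_startE (k := k') jk pp) setU11.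
case/andP=> _ /eqP e; rewrite mulrC big_setU1 //=.
by rewrite -e !inE eqxx.
Qed.

End IntervalPartitionSums.

(** * Boolean cumulants from a recursion for the moments *)

Section CumulantRecursion.
Variables (R : realType) (d : nat).

Lemma prod_enum_segment (n a b : nat) (t : n.-tuple 'I_d) : (b <= n)%N ->
  \prod_(i <- enum (segment n a b)) ncvar R (tnth t i) =
  ncmonom R (drop a (take b t)).
Proof.
case: n t => [|n] t bn.
  have -> : enum (segment 0 a b) = [::] by case: (enum _) => [|[]].
  by move: bn; rewrite leqn0 => /eqP ->; rewrite take0 /ncmonom !big_nil.
pose x0 := tnth t ord0; pose G i := ncvar R (nth x0 t i).
have -> : \prod_(i <- enum (segment n.+1 a b)) ncvar R (tnth t i) =
          \prod_(a <= i < b) G i.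
  rewrite (big_nat_widenl _ 0) // (big_nat_widen _ _ _ _ _ bn).
  rewrite /index_iota subn0 -val_enum_ord big_map.
  rewrite [enum (segment _ _ _)]/enum_mem big_filter -enumT.
  by apply: eq_big => i; rewrite ?inE // /G (tnth_nth x0).
rewrite /ncmonom (big_nth x0) size_drop size_takel ?size_tuple //.
rewrite -{1}[a]add0n big_addn; apply: eq_big_nat => i /andP[_ ib].
by rewrite nth_drop nth_take -?ltn_subRL // addnC.
Qed.

(** By strong induction on u: the cumulants of words shorter than x_u x_j are
    known, hence so are the partial sums over interval partitions of proper
    prefixes, which equal the moments of these prefixes.  The two recursions
    for the moment of x_u x_j then agree except perhaps in their l = 0 terms,
    eta[x_u x_j] and b u j, so these agree too. *)
Lemma boolean_cumulant_of_rec (phi eta : {scalar ncpoly R d})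
    (b : seq 'I_d -> 'I_d -> R[i]) :
    is_boolean_cumulant phi eta -> phi 1 = 1 ->
    (forall u j, phi (ncmonom R (rcons u j)) =
       \sum_(l < (size u).+1) phi (ncmonom R (take l u)) * b (drop l u) j) ->
  forall u j, eta (ncmonom R (rcons u j)) = b u j.
Proof.
move=> [_ heta] phi1 rec u; have [N] := ubnP (size u).
elim: N u => // N IHN u; rewrite ltnS => uN j.
have IH v i : (size v < size u)%N -> eta (ncmonom R (rcons v i)) = b v i.
  by move=> vu; apply: IHN; exact: leq_trans vu uN.
pose t := in_tuple (rcons u j); have st : size (rcons u j) = (size u).+1 by exact: size_rcons.
pose w (B : {set 'I_(size (rcons u j))}) := eta (\prod_(i <- enum B) ncvar R (tnth t i)).
have w_segment a k : (k <= size (rcons u j))%N ->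
    w (segment _ a k) = eta (ncmonom R (drop a (take k t))).
  by move=> kt; rewrite /w prod_enum_segment.
have partial k : (k <= size u)%N -> ipsum w k = phi (ncmonom R (take k u)).
  have [K] := ubnP k; elim: K k => // K IHK [|k]; rewrite ltnS => kK ku.
    by rewrite ipsum0 take0 /ncmonom big_nil phi1.
  rewrite ipsum_rec ?st ?(ltnW ku) //; last by rewrite ltnS ltnW.
  rewrite (take_nth j ku) rec size_takel ?(ltnW ku) //.
  apply: eq_bigr => l _; have lk : (l <= k)%N by rewrite -ltnS.
  rewrite IHK ?(leq_ltn_trans lk) ?(leq_trans lk (ltnW ku)) //.
  rewrite take_takel // w_segment ?st ?ltnS ?(ltnW ku) //.
  rewrite /= -cats1 takel_cat // (take_nth j ku) drop_rcons ?size_takel ?(ltnW ku) //.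
  by rewrite IH // size_drop size_takel ?(ltnW ku) // (leq_ltn_trans (leq_subr _ _)).
have := heta _ t; rewrite -[LHS]/(phi (ncmonom R (rcons u j))) rec.
have -> : \sum_(p | interval_partition p)
    \prod_(B in p) eta (\prod_(i <- enum B) ncvar R (tnth t i)) =
    ipsum w (size u).+1.
  apply: eq_bigl => p; rewrite /interval_partition_of; congr (partition p _ && _).
  by apply/setP => i; rewrite !inE /= -st ltn_ord.
rewrite ipsum_rec ?st // !big_ord_recl /= take0 drop0 ipsum0.
(* Cancelling the terms l > 0 leaves eta[x_u x_j] = b u j. *)
rewrite /ncmonom big_nil phi1 !mul1r w_segment ?st // drop0 -st take_size => e.
apply/esym/(addIr _ (etrans e _)); congr (_ + _); apply: eq_bigr => l _.
rewrite partial // w_segment //= take_size drop_rcons //=.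
by rewrite IH // size_drop ltn_subrL /= (leq_ltn_trans _ (ltn_ord l)).
Qed.

End CumulantRecursion.

(** * Operators on the full Fock space *)

Section FockOperators.
Variables (R : realType) (d : nat).
Local Notation fock := (fock R d).
Implicit Types (h : seq 'I_d -> fock) (f g : fock) (u v w : seq 'I_d).

Lemma flin_on (D : {fset seq 'I_d}) h f : (msupp f `<=` D)%fset ->
  flin h f = \sum_(v <- D) f@_v *: h v.
Proof.
move=> fD; rewrite /flin; apply/big_fset_incl => // v _ /mcoeff_outdom ->.
by rewrite scale0r.
Qed.

Lemma flin_is_linear h : linear (flin h).
Proof.
move=> a f g; pose D := (msupp f `|` msupp g)%fset.
have fD : (msupp f `<=` D)%fset by exact: fsubsetUl.
have gD : (msupp g `<=` D)%fset by exact: fsubsetUr.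
have afgD : (msupp (a *: f + g) `<=` D)%fset.
  apply: fsubset_trans (msuppD_le _ _) _.
  exact: fsetSU (msuppZ_le _ _).
rewrite !(flin_on _ fD) (flin_on _ gD) (flin_on _ afgD).
rewrite scaler_sumr -big_split /=; apply: eq_bigr => v _.
by rewrite mcoeffD mcoeffZ scalerDl scalerA.
Qed.

HB.instance Definition _ h := GRing.isLinear.Build R[i] fock fock *:%R (flin h)
  (flin_is_linear h).

Lemma flin_basis h u : flin h (fbasis R u) = h u.
Proof. by rewrite /flin /fbasis msuppU oner_eq0 big_seq_fset1 mcoeffUU scale1r. Qed.

Lemma fock_expand f : f = \sum_(v <- msupp f) f@_v *: fbasis R v.
Proof.
rewrite {1}[f]monalgE; apply: eq_bigr => v _.
by apply/malgP => k; rewrite mcoeffZ !mcoeffU mulr_natr.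
Qed.

Lemma linear_fock_ext (L L' : {linear fock -> fock}) :
  (forall v, L (fbasis R v) = L' (fbasis R v)) -> L =1 L'.
Proof.
move=> LL' f; rewrite (fock_expand f) !linear_sum; apply: eq_bigr => v _.
by rewrite !linearZ /= LL'.
Qed.

Lemma linear_fock_addE (L L1 L2 : {linear fock -> fock}) :
    (forall v, L (fbasis R v) = L1 (fbasis R v) + L2 (fbasis R v)) ->
  forall f, L f = L1 f + L2 f.
Proof.
move=> LL f; rewrite (fock_expand f) !linear_sum -big_split /=.
by apply: eq_bigr => v _; rewrite !linearZ /= LL scalerDr.
Qed.

Lemma fdot_basis u f : fdot (fbasis R u) f = f@_u.
Proof. by rewrite /fdot /fbasis msuppU oner_eq0 big_seq_fset1 mcoeffUU rmorph1 mul1r. Qed.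

HB.instance Definition _ k (M : tmx R d k) :=
  GRing.Linear.copy (op_level M) (flin _).
HB.instance Definition _ (M : forall k, tmx R d k) :=
  GRing.Linear.copy (op_diag M) (flin _).
HB.instance Definition _ (i : 'I_d) :=
  GRing.Linear.copy (@acre R d i) (flin _).
HB.instance Definition _ (i : 'I_d) :=
  GRing.Linear.copy (@aann R d i) (flin _).
HB.instance Definition _ (i : 'I_d) :=
  GRing.Linear.copy (@bann R d i) (flin _).
HB.instance Definition _ (M : forall k, tmx R d k) (i : 'I_d) :=
  GRing.Linear.copy (btann M i) (flin _).

Lemma tcoef_out k (M : tmx R d k) u v : size v != k -> tcoef M u v = 0.
Proof.
move=> vk; rewrite /tcoef [insub v]insubF ?(negbTE vk) //.
by case: insub.
Qed.

Lemma op_level_out k (M : tmx R d k) v :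
  size v != k -> op_level M (fbasis R v) = 0.
Proof.
by move=> vk; rewrite /op_level flin_basis big1 // => u _; rewrite tcoef_out ?scale0r.
Qed.

Lemma op_level_vac (M : tmx R d 0) :
  op_level M (vac R d) = tcoef M [::] [::] *: vac R d.
Proof.
rewrite /op_level /vac flin_basis (big_pred1 [tuple]) // => u.
by apply/esym/eqP; exact: tuple0.
Qed.

Lemma op_level_diag k (M : tmx R d k) (v : k.-tuple 'I_d) : is_diag_mx M ->
  op_level M (fbasis R v) = tcoef M v v *: fbasis R v.
Proof.
move=> /is_diag_mxP dM; rewrite /op_level flin_basis (bigD1 v) //= big1 ?addr0 //.
move=> u uv; rewrite /tcoef !valK dM ?scale0r //.
by apply: contra_neq uv => /val_inj/enum_rank_inj.
Qed.

Lemma op_diag_basis (M : forall k, tmx R d k) v :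
  op_diag M (fbasis R v) = op_level (M (size v)) (fbasis R v).
Proof. exact: flin_basis. Qed.

Lemma aann_vac (i : 'I_d) : aann i (vac R d) = 0.
Proof. exact: flin_basis. Qed.

Variables (C : forall k, tmx R d k) (T : 'I_d -> forall k, tmx R d k).
Hypothesis C1_diag : is_diag_mx (C 1).

(** The operator X_i - Z_i has rank at most one.  As C^(1) is diagonal, e_i is
    the only basis vector that C^(1) and then a_i^- can send to a nonzero
    multiple of Omega. *)
Lemma bann_C1 (i : 'I_d) f :
  bann i (op_level (C 1) f) = (tcoef (C 1) [:: i] [:: i] * f@_[:: i]) *: vac R d.
Proof.
pose h (v : seq 'I_d) := (tcoef (C 1) [:: i] [:: i] * (v == [:: i])%:R) *: vac R d.
have -> : (tcoef (C 1) [:: i] [:: i] * f@_[:: i]) *: vac R d = flin h f.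
  rewrite {1}(fock_expand f) raddf_sum /= mulr_sumr scaler_suml /flin.
  apply: eq_bigr => v _; rewrite mcoeffZ /fbasis mcoeffU /h scalerA.
  by rewrite mulrCA.
apply: (linear_fock_ext (L := bann i \o op_level (C 1))) => v; rewrite [RHS]flin_basis /h /=.
have [v1|v1] := eqVneq (size v) 1%N; last first.
  rewrite [op_level _ _]op_level_out // linear0.
  by case: (v =P [:: i]) v1 => [->//|_ _]; rewrite mulr0 scale0r.
case: v v1 => [//|j [|//]] _; rewrite (op_level_diag [tuple j]) //= linearZ /=.
rewrite [bann _ _]flin_basis /= [aann _ _]flin_basis /=.
rewrite eqseq_cons eqxx andbT.
have [<-|ij] := eqVneq i j.
  by rewrite mulr1 scale1r.
by rewrite scale0r mulr0 scale0r scaler0.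
Qed.

(** The component of degree 0 dies under a_i^-, the one of degree 1 is the
    Boolean part, and those of degree at least 2 give the rest. *)
Lemma aann_diag_split (i : 'I_d) f :
  aann i (op_diag C f) = btann C i f + bann i (op_level (C 1) f).
Proof.
apply: (linear_fock_addE (L := aann i \o op_diag C) (L1 := btann C i)
  (L2 := bann i \o op_level (C 1))) => v /=.
rewrite op_diag_basis [btann _ _ _]flin_basis.
case: v => [|j [|k v]] /=.
- rewrite add0r op_level_vac linearZ /= aann_vac scaler0.
  by rewrite [op_level _ _]op_level_out // linear0.
- rewrite (op_level_diag [tuple j]) //= !linearZ /= [bann _ _]flin_basis /=.
  by rewrite add0r.
- by rewrite [op_level (C 1) _]op_level_out // linear0 addr0 op_diag_basis.
Qed.

Lemma opZE (i : 'I_d) f : opZ C T i f = acre i f + op_diag (T i) f + btann C i f.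
Proof.
have addrDK (V : zmodType) (x y z : V) : x + (y + z) - z = x + y.
  by rewrite addrA addrK.
by rewrite /opZ /opX aann_diag_split; exact: addrDK.
Qed.

Lemma opX_opZ (i : 'I_d) f : opX C T i f =
  opZ C T i f + (tcoef (C 1) [:: i] [:: i] * f@_[:: i]) *: vac R d.
Proof. by rewrite -bann_C1 subrK. Qed.

Lemma opX_is_linear (i : 'I_d) : linear (opX C T i).
Proof.
exact: (linearP (@acre R d i \+ op_diag (T i) \+ (aann i \o op_diag C))).
Qed.

HB.instance Definition _ (i : 'I_d) :=
  GRing.isLinear.Build R[i] fock fock *:%R (opX C T i) (opX_is_linear i).

Lemma opword_is_linear u : linear (opword (opX C T) u).
Proof.
elim: u => [|i u IHu] a f g //=.
by rewrite IHu linearP.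
Qed.

HB.instance Definition _ u :=
  GRing.isLinear.Build R[i] fock fock *:%R (opword (opX C T) u) (opword_is_linear u).

Lemma opword_rcons (Y : 'I_d -> fock -> fock) u j f :
  opword Y (rcons u j) f = opword Y u (Y j f).
Proof. by elim: u => //= i u ->. Qed.

Definition fmoment u : R[i] := (opword (opX C T) u (vac R d))@_[::].

(** The candidate for the Boolean cumulant of x_u x_j; detaching the last
    letter turns the singleton word into the case of empty u. *)
Definition fcumulant u j : R[i] :=
  if u is i :: u' then
    tcoef (C 1) [:: i] [:: i] *
      fdot (fbasis R [:: i]) (opword (opZ C T) u' (fbasis R [:: j]))
  else tcoef (T j 0) [::] [::].

(** The word u is cut at the first factor, in the order of application, that
    acts by its rank-one part: the factors to its right act by Z, while those
    to its left still act by the full X, and on Omega. *)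
Lemma opX_word_split u j :
  opword (opX C T) u (fbasis R [:: j]) =
  opword (opZ C T) u (fbasis R [:: j]) +
  \sum_(l < size u) fcumulant (drop l u) j *: opword (opX C T) (take l u) (vac R d).
Proof.
elim: u => [|i u IHu]; first by rewrite big_ord0 addr0.
rewrite big_ord_recl /= IHu linearD /= opX_opZ -fdot_basis -addrA.
by congr (_ + (_ + _)); rewrite linear_sum; apply: eq_bigr => l _; rewrite linearZ.
Qed.

Lemma mcoeff_linear_eq0 (L : {linear fock -> fock}) f v :
    (forall w, f@_w != 0 -> (L (fbasis R w))@_v = 0) -> (L f)@_v = 0.
Proof.
move=> Lw; rewrite (fock_expand f) linear_sum raddf_sum big1_seq // => w /=.
by rewrite -mcoeff_neq0 => /Lw Lw0; rewrite linearZ /= mcoeffZ Lw0 mulr0.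
Qed.

(** Removing the Boolean annihilation closes the only way from degree 1 back
    to Omega. *)
Lemma opZ_no_vac (i : 'I_d) f : f@_[::] = 0 -> (opZ C T i f)@_[::] = 0.
Proof.
have add_eq0 (x y : R[i]) : x = 0 -> y = 0 -> x + y = 0.
  by move=> -> ->; exact: addr0.
move=> f0; rewrite opZE 2!mcoeffD; apply: (add_eq0); first apply: (add_eq0).
- apply: mcoeff_linear_eq0 => w _.
  by rewrite /= [acre _ _]flin_basis /fbasis mcoeffU.
- apply: mcoeff_linear_eq0 => -[|k w]; first by rewrite f0 eqxx.
  move=> _; rewrite /= op_diag_basis [op_level _ _]flin_basis raddf_sum big1 //.
  by move=> -[[|a u] su] _ //=; rewrite mcoeffZ /fbasis mcoeffU mulr0.
- apply: mcoeff_linear_eq0 => -[|j [|k w]] _; rewrite /= [btann _ _ _]flin_basis /=;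
    try exact: mcoeff0.
  rewrite op_diag_basis [op_level _ _]flin_basis linear_sum raddf_sum big1 //.
  move=> -[[|a [|b u]] su] _ //=.
  rewrite linearZ /= [aann _ _]flin_basis /= scalerA mcoeffZ.
  by rewrite /fbasis mcoeffU mulr0.
Qed.

Lemma opZ_word_no_vac u j : (opword (opZ C T) u (fbasis R [:: j]))@_[::] = 0.
Proof.
elim: u => [|i u IHu] /=; first by rewrite /fbasis mcoeffU.
exact: opZ_no_vac.
Qed.

Lemma opX_vac (j : 'I_d) :
  opX C T j (vac R d) = fbasis R [:: j] + tcoef (T j 0) [::] [::] *: vac R d.
Proof.
have diag_vac M : op_diag M (vac R d) = tcoef (M 0%N) [::] [::] *: vac R d.
  by rewrite {1}/vac op_diag_basis op_level_vac.
rewrite /opX !diag_vac linearZ /= aann_vac scaler0 addr0.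
by rewrite {1}/vac [acre _ _]flin_basis.
Qed.

(** The same last-block recursion as for interval partitions; its term
    l = |u| comes from the vacuum component of X_j Omega. *)
Lemma fmoment_rec u j : fmoment (rcons u j) =
  \sum_(l < (size u).+1) fmoment (take l u) * fcumulant (drop l u) j.
Proof.
rewrite /fmoment opword_rcons opX_vac linearD linearZ /= opX_word_split.
rewrite !mcoeffD opZ_word_no_vac add0r mcoeffZ big_ord_recr /=.
rewrite take_size drop_size mulrC; congr (_ + _).
by rewrite raddf_sum; apply: eq_bigr => l _; rewrite /= mcoeffZ mulrC.
Qed.

End FockOperators.

(** * The Boolean cumulants of phi *)

Lemma ncmonomE (R : realType) (d : nat) (u : seq 'I_d) :
  ncmonom R u = << FMonom u >>.
Proof.
elim: u => [|i u IHu]; first by rewrite /ncmonom big_nil -fmoneE.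
rewrite /ncmonom big_cons -/(ncmonom R u) IHu /ncvar malgM_def fgmulUU mulr1.
by congr << _ >>; rewrite fmuE; apply/val_inj; rewrite /= fmM.
Qed.

Lemma opeval_ncmonom (R : realType) (d : nat) (Y : 'I_d -> fock R d -> fock R d)
  (u : seq 'I_d) f : opeval Y (ncmonom R u) f = opword Y u f.
Proof.
by rewrite /opeval ncmonomE msuppU oner_eq0 big_seq_fset1 mcoeffUU scale1r.
Qed.

Theorem corollary14 (R : realType) (d : nat)
    (C : forall k, tmx R d k) (T : 'I_d -> forall k, tmx R d k)
    (phi eta : {scalar ncpoly R d})
    (hCT : fock_data C T)
    (hstate : is_state phi) (hMOPS : has_MOPS phi)
    (hphi : forall P : ncpoly R d,
       phi P = fdot (vac R d) (opeval (opX C T) P (vac R d)))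
    (heta : is_boolean_cumulant phi eta) :
  [/\ forall (i : 'I_d) (f : fock R d),
        opZ C T i f = acre i f + op_diag (T i) f + btann C i f,
      forall i : 'I_d, eta (ncvar R i) = tcoef (T i 0%N) [::] [::]
    & forall (i j : 'I_d) (u : seq 'I_d),
        eta (ncvar R i * ncmonom R u * ncvar R j) =
          tcoef (C 1%N) [:: i] [:: i] *
            fdot (fbasis R [:: i]) (opword (opZ C T) u (fbasis R [:: j]))
     /\ eta (ncvar R i * ncmonom R u * ncvar R j) =
          fdot (vac R d)
            (bann i (op_level (C 1%N)
               (opword (opZ C T) u (acre j (vac R d)))))].
Proof.
have [C_diag _ _] := hCT; have C1_diag := C_diag 1%N isT.
have momentE u : phi (ncmonom R u) = fmoment C T u.
  by rewrite hphi opeval_ncmonom fdot_basis.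
have phi1 : phi 1 = 1 by case: hstate.
have etaE u j : eta (ncmonom R (rcons u j)) = fcumulant C T u j.
  move: u j; apply: (boolean_cumulant_of_rec heta phi1) => u j.
  rewrite momentE (fmoment_rec _ C1_diag).
  by apply: eq_bigr => l _; rewrite momentE.
have eta_ends i j u : eta (ncvar R i * ncmonom R u * ncvar R j) =
    fcumulant C T (i :: u) j.
  by rewrite -etaE rcons_cons -cats1 /ncmonom big_cons big_cat big_seq1 mulrA.
split=> [i f|i|i j u]; first exact: opZE.
  by have := etaE [::] i; rewrite /ncmonom big_seq1.
rewrite eta_ends; split=> //.
have -> : acre j (vac R d) = fbasis R [:: j] by exact: flin_basis.
by rewrite bann_C1 // fdot_basis mcoeffZ mcoeffUU mulr1 -fdot_basis.
Qed.
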